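(* Let $R$ be a weakly Laskerian ring and $A$ a ring extension of $R$ (i.e. a commutative ring containing $R$ as a subring) which is finitely generated as an $R$-module. Then $A$ is also a weakly Laskerian ring.
   Context: All rings are commutative with identity. For an $R$-module $M$, $\operatorname{Ass}_R M$ denotes the set of prime ideals $\mathfrak p$ of $R$ of the form $\mathfrak p=(0:_R x)$ for some $x\in M$. An $R$-module $M$ is weakly Laskerian if $\operatorname{Ass}_R(M/N)$ is a finite set for every submodule $N$ of $M$. A ring is weakly Laskerian if it is weakly Laskerian as a module over itself. *)

(* Defs.v *)
From HB Require Import structures.
From mathcomp Require Import all_boot all_algebra.
From mathcomp Require Import generic_quotient ring_quotient.
From mathcomp Require Import boolp classical_sets functions cardinality.

Set Implicit Arguments.
Unset Strict Implicit.
Unset Printing Implicit Defensive.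

Import GRing.Theory.
Local Open Scope ring_scope.
Local Open Scope quotient_scope.

(* Commutative rings are [comPzRingType]s, so the zero ring is allowed.  A
   submodule is a boolean predicate [N : submodClosed M]; under the classical
   axioms of [boolp] these are all the submodules of [M]. *)

Section QuotientModule.
Variables (R : comPzRingType) (M : lmodType R) (N : submodClosed M).

Fact submod_oppr_closed : oppr_closed N.
Proof. by move=> x xN; rewrite -scaleN1r rpredZ. Qed.

Definition submod_pred : {pred M} := N.

HB.instance Definition _ := GRing.SubmodClosed.copy submod_pred N.
HB.instance Definition _ :=
  GRing.isOppClosed.Build M submod_pred submod_oppr_closed.

Definition quot_module : Type := (Quotient.quot (submod_pred : zmodClosed M)).

HB.instance Definition _ := GRing.Zmodule.on quot_module.

Definition quot_proj (x : M) : quot_module :=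
  \pi_(Quotient.quot (submod_pred : zmodClosed M)) x.

Definition quot_scale (a : R) (u : quot_module) : quot_module :=
  quot_proj (a *: repr (u : (Quotient.quot (submod_pred : zmodClosed M)))).

Fact quot_projP (x y : M) : quot_proj x = quot_proj y <-> x - y \in N.
Proof.
rewrite -[_ \in N]/(x - y \in submod_pred) Quotient.idealrBE.
by split => [/eqP|/eqP].
Qed.

Fact quot_proj_repr (u : quot_module) :
  quot_proj (repr (u : (Quotient.quot (submod_pred : zmodClosed M)))) = u.
Proof. exact: reprK. Qed.

Fact quot_projD (x y : M) : quot_proj (x + y) = quot_proj x + quot_proj y.
Proof. exact: Quotient.pi_add. Qed.

Fact quot_projZ (a : R) (x : M) :
  quot_scale a (quot_proj x) = quot_proj (a *: x).
Proof.
apply/quot_projP; rewrite -scalerBr rpredZ //.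
by apply/quot_projP; rewrite quot_proj_repr.
Qed.

Fact quot_scalerA (a b : R) (u : quot_module) :
  quot_scale a (quot_scale b u) = quot_scale (a * b) u.
Proof. by rewrite -[u]quot_proj_repr !quot_projZ scalerA. Qed.

Fact quot_scale1r : left_id 1 quot_scale.
Proof. by move=> u; rewrite -[u]quot_proj_repr quot_projZ scale1r. Qed.

Fact quot_scalerDr : right_distributive quot_scale +%R.
Proof.
move=> a u v; rewrite -[u]quot_proj_repr -[v]quot_proj_repr.
by rewrite -quot_projD !quot_projZ scalerDr quot_projD.
Qed.

Fact quot_scalerDl (u : quot_module) : {morph quot_scale^~ u : a b / a + b}.
Proof.
by move=> a b; rewrite -[u]quot_proj_repr !quot_projZ scalerDl quot_projD.
Qed.

HB.instance Definition _ := GRing.Zmodule_isLmodule.Build R quot_module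
  quot_scalerA quot_scale1r quot_scalerDr quot_scalerDl.

Fact quot_proj_scale (a : R) (x : M) : quot_proj (a *: x) = a *: quot_proj x.
Proof. by rewrite -quot_projZ. Qed.

End QuotientModule.

Section RestrictionOfScalars.
Variables (R A : comPzRingType) (f : {rmorphism R -> A}).

(* The unused argument lets the module structure be recovered from the type. *)
Definition restrict_scalars (g : {rmorphism R -> A}) : Type := A.
Local Notation Af := (restrict_scalars f).

HB.instance Definition _ := GRing.Zmodule.copy Af A.

Definition restr_scale (a : R) (x : Af) : Af := f a * (x : A).

Fact restr_scalerA (a b : R) (x : Af) :
  restr_scale a (restr_scale b x) = restr_scale (a * b) x.
Proof. by rewrite /restr_scale rmorphM mulrA. Qed.

Fact restr_scale1r : left_id 1 restr_scale.
Proof. by move=> x; rewrite /restr_scale rmorph1 mul1r. Qed.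

Fact restr_scalerDr : right_distributive restr_scale +%R.
Proof. by move=> a x y; rewrite /restr_scale -mulrDr. Qed.

Fact restr_scalerDl (x : Af) : {morph restr_scale^~ x : a b / a + b}.
Proof. by move=> a b; rewrite /restr_scale rmorphD mulrDl. Qed.

HB.instance Definition _ := GRing.Zmodule_isLmodule.Build R Af
  restr_scalerA restr_scale1r restr_scalerDr restr_scalerDl.

Fact restr_scaleE (a : R) (x : Af) : a *: x = f a * (x : A).
Proof. by []. Qed.

End RestrictionOfScalars.

Local Open Scope classical_set_scope.

(* The library's [prime_idealr] is restricted to nontrivial rings. *)
Definition prime_ideal (R : comPzRingType) (p : set R) : Prop :=
  [/\ p 0,
      forall a b, p a -> p b -> p (a + b),
      forall r a, p a -> p (r * a),
      ~ p 1
    & forall a b, p (a * b) -> p a \/ p b].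

Definition annihilator (R : comPzRingType) (M : lmodType R) (x : M) : set R :=
  [set r | r *: x = 0].

Definition Ass (R : comPzRingType) (M : lmodType R) : set (set R) :=
  [set p | prime_ideal p /\ exists x : M, p = annihilator x].

Definition weakly_Laskerian (R : comPzRingType) (M : lmodType R) : Prop :=
  forall N : submodClosed M, finite_set (Ass (quot_module N)).

Definition weakly_Laskerian_ring (R : comPzRingType) : Prop :=
  weakly_Laskerian (R^o : lmodType R).

Definition finitely_generated (R : comPzRingType) (M : lmodType R) : Prop :=
  exists (n : nat) (g : 'I_n -> M),
    forall x : M, exists c : 'I_n -> R, x = \sum_(i < n) c i *: g i.

(* Main.v *)
Require Import Defs.
From HB Require Import structures.
From mathcomp Require Import all_boot all_algebra.
From mathcomp Require Import boolp classical_sets functions cardinality.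

(** The modules [M] for which every [Ass (M / N)] is finite are closed under
    extensions, so [A] is weakly Laskerian as an [R]-module.  If a prime [Q] of
    [A] is the annihilator of [x] in [A / J], then its contraction is the
    annihilator of [x] over [R], so contraction maps [Ass_A (A / J)] into the
    finite set [Ass_R (A / J)].  It remains to see that at most [n] primes of
    [A] lie over a prime [p] of [R] if [n] elements generate [A]: given distinct
    [Q_0, .., Q_n] over [p], listed so that none contains a later one, choose
    [e_i] in the product of [Q_(i+1), .., Q_n] but outside [Q_i].  Reducing a
    relation between the [e_i] modulo the [Q_i] shows that its coefficients lie
    in [p], yet any [n + 1] elements of [A] are linearly dependent modulo [p]. *)

Set Implicit Arguments.
Unset Strict Implicit.
Unset Printing Implicit Defensive.

Import GRing.Theory.
Local Open Scope ring_scope.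
Local Open Scope classical_set_scope.

(** * Prime ideals and linear dependence modulo a prime *)

Section PrimeIdeal.
Variables (R : comPzRingType) (p : set R).
Hypothesis p_prime : prime_ideal p.

Lemma prime_ideal0 : p 0. Proof. by case: p_prime. Qed.

Lemma prime_idealD a b : p a -> p b -> p (a + b).
Proof. by case: p_prime => _ + _ _ _; apply. Qed.

Lemma prime_idealMl r a : p a -> p (r * a).
Proof. by case: p_prime => _ _ + _ _; apply. Qed.

Lemma prime_idealMr r a : p a -> p (a * r).
Proof. by rewrite mulrC; apply: prime_idealMl. Qed.

Lemma prime_ideal1 : ~ p 1. Proof. by case: p_prime. Qed.

Lemma prime_idealM a b : p (a * b) -> p a \/ p b.
Proof. by case: p_prime => _ _ _ _; apply. Qed.

Lemma prime_idealDr a b : p b -> p (a + b) -> p a.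
Proof.
move=> pb pab; rewrite -[a](addrK b); apply: prime_idealD => //.
by rewrite -mulN1r; apply: prime_idealMl.
Qed.

Lemma prime_ideal_sum n (F : 'I_n -> R) :
  (forall i, p (F i)) -> p (\sum_(i < n) F i).
Proof.
by move=> pF; apply: big_ind => //; [apply: prime_ideal0 | apply: prime_idealD].
Qed.

(* Gaussian elimination over the domain [R / p]. *)
Lemma prime_row_dependence n (C : 'I_n.+1 -> 'I_n -> R) :
  exists2 d : 'I_n.+1 -> R, exists i, ~ p (d i) &
    forall j, p (\sum_(i < n.+1) d i * C i j).
Proof.
elim: n => [|n IH] in C *.
  by exists (fun=> 1) => [|[]//]; exists ord0; apply: prime_ideal1.
have [pC|/existsNP[k pCk]] := pselect (forall i, p (C i ord0)).
  have [d [k pdk] dP] := IH (fun i j => C (lift ord0 i) (lift ord0 j)).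
  exists (fun i => if unlift ord0 i is Some i' then d i' else 0) => [|j].
    by exists (lift ord0 k); rewrite liftK.
  rewrite big_ord_recl unlift_none mul0r add0r.
  under eq_bigr do rewrite liftK.
  have [j'|->] := unliftP ord0 j; first by move->; apply: dP.
  by apply: prime_ideal_sum => i; apply: prime_idealMl.
(* The pivot [c] lies outside [p]: each other row is multiplied by [c] and reduced by a multiple of
   row [k], which clears column 0. *)
pose c := C k ord0.
have [d [i pdi] dP] := IH (fun i j =>
  c * C (lift k i) (lift ord0 j) - C (lift k i) ord0 * C k (lift ord0 j)).
(* The coefficient of row [k] is the one that cancels column 0 exactly; [d i * c] stays outside [p]
   by primality. *)
exists (fun i => if unlift k i is Some i' then d i' * c
                 else - \sum_(i' < n.+1) d i' * C (lift k i') ord0) => [|j].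
  by exists (lift k i); rewrite liftK => /prime_idealM[].
rewrite (bigD1_ord k) //= unlift_none mulNr mulr_suml -sumrN -big_split /=.
under eq_bigr do rewrite liftK.
have [j'|->] := unliftP ord0 j.
  move->; under eq_bigr do rewrite addrC -!mulrA -mulrBr.
  exact: dP.
rewrite big1; first exact: prime_ideal0.
by move=> i' _; rewrite -!mulrA [c * _]mulrC addNr.
Qed.

End PrimeIdeal.

(** Multiply together one element of each [Q] outside [p]; primality of [p] keeps the product
    outside. *)
Lemma prime_avoid_product (R : comPzRingType) (p : set R) (s : seq (set R)) :
    prime_ideal p -> (forall Q, Q \in s -> prime_ideal Q /\ ~ Q `<=` p) ->
  exists2 y, ~ p y & forall Q, Q \in s -> Q y.
Proof.
move=> p_prime; elim: s => [_|Q s IH sP].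
  by exists 1 => //; apply: prime_ideal1.
have sP' Q' : Q' \in s -> prime_ideal Q' /\ ~ Q' `<=` p.
  by move=> sQ'; apply: sP; rewrite inE sQ' orbT.
have [y py sy] := IH sP'.
have [Q_prime /existsNP[z /not_implyP[Qz pz]]] := sP Q (mem_head _ _).
exists (z * y) => [/(prime_idealM p_prime)[]//|Q'].
rewrite inE => /predU1P[->|sQ']; first exact: prime_idealMr.
by have [Q'_prime _] := sP' Q' sQ'; apply: prime_idealMl (sy _ sQ').
Qed.

(** Extracting a minimal set repeatedly gives an order in which no prime contains a later one. *)
Lemma minimal_set_in_seq T (Q : set T) (s : seq (set T)) :
  exists2 Q0, Q0 \in Q :: s & forall Q', Q' \in Q :: s -> Q' `<=` Q0 -> Q' = Q0.
Proof.
elim: s => [|Q1 s IH] in Q *.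
  exists Q => [|Q']; first exact: mem_head.
  by rewrite mem_seq1 => /eqP.
have [Q0 sQ0 Q0min] := IH Q1.
have [QQ0|nQQ0] := pselect (Q `<=` Q0); last first.
  exists Q0 => [|Q']; first by rewrite inE sQ0 orbT.
  by rewrite inE => /predU1P[->//|]; apply: Q0min.
exists Q => [|Q']; first exact: mem_head.
rewrite inE => /predU1P[->//|sQ' Q'Q]; apply/seteqP; split=> //.
by rewrite (Q0min Q') //; apply: subset_trans QQ0.
Qed.

(** * Primes of [A] over a fixed prime of [R] *)

Section Fibre.
Variables (R A : comPzRingType) (f : {rmorphism R -> A}).

Definition lies_over (p : set R) (Q : set A) : Prop :=
  prime_ideal Q /\ f @^-1` Q = p.

Lemma prime_preimage (Q : set A) : prime_ideal Q -> prime_ideal (f @^-1` Q).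
Proof.
move=> Q_prime; split; rewrite /preimage /=.
- by rewrite rmorph0; apply: prime_ideal0.
- by move=> a b; rewrite rmorphD; apply: prime_idealD.
- by move=> a b; rewrite rmorphM; apply: prime_idealMl.
- by rewrite rmorph1; apply: prime_ideal1.
- by move=> a b; rewrite rmorphM; apply: prime_idealM.
Qed.

Lemma fibre_independent (p : set R) n (s : seq (set A)) :
    size s = n -> uniq s -> (forall Q, Q \in s -> lies_over p Q) ->
  exists e : 'I_n -> A, forall d : 'I_n -> R,
    (forall Q, Q \in s -> Q (\sum_(i < n) f (d i) * e i)) -> forall i, p (d i).
Proof.
elim: n s => [|n IH] s ss us sp; first by exists (fun=> 0) => d _ [].
case: s ss us sp => // Q1 s1; set s := Q1 :: s1 => ss us sp.
have [Q sQ Qmin] := minimal_set_in_seq Q1 s1.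
have memt Q' : Q' \in rem Q s -> Q' != Q /\ Q' \in s.
  by rewrite mem_rem_uniq // => /andP[].
have [||Q' /memt[_]/sp//|e eP] := IH (rem Q s).
- by rewrite size_rem // ss.
- exact: rem_uniq.
have [Q_prime Qp] := sp Q sQ.
have [Q' /memt[nQ' sQ']|y Qy ty] := prime_avoid_product Q_prime (s := rem Q s).
  by split=> [|Q'Q]; [case: (sp Q' sQ') | move/eqP: nQ'; apply; apply: Qmin].
exists (fun i => if unlift ord0 i is Some i' then e i' else y) => d dP.
have {dP} dP Q' : Q' \in s ->
    Q' (f (d ord0) * y + \sum_(i < n) f (d (lift ord0 i)) * e i).
  move=> /dP; rewrite big_ord_recl unlift_none.
  by under eq_bigr do rewrite liftK.
(* Modulo any prime of [s] other than [Q] the term with [y] vanishes, leaving a relation between the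
   [e i] alone. *)
have pd i : p (d (lift ord0 i)).
  apply: (eP (fun i => d (lift ord0 i))) => Q' tQ'.
  have [_ sQ'] := memt _ tQ'; have [Q'_prime _] := sp _ sQ'.
  have := dP _ sQ'; rewrite addrC; apply: prime_idealDr => //.
  by apply: prime_idealMl => //; apply: ty.
move=> i; have [j ->|->] := unliftP ord0 i; first exact: pd.
(* Modulo [Q] only the term with [y] survives, and [y] is not in [Q]. *)
suff : Q (f (d ord0) * y) by case/prime_idealM => //; rewrite -Qp.
apply: prime_idealDr (dP _ sQ) => //; apply: prime_ideal_sum => // j.
by apply: prime_idealMr => //; have := pd j; rewrite -Qp.
Qed.

Lemma finite_fibre (p : set R) :
    prime_ideal p -> finitely_generated (restrict_scalars f) ->
  finite_set (lies_over p).
Proof.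
move=> p_prime [n [g gP]]; apply: contrapT.
move=> /(infinite_set_fset n.+1)[B Bp nB].
pose s := take n.+1 (finmap.enum_fset B).
have sp Q : Q \in s -> lies_over p Q by move=> /mem_take BQ; apply: Bp.
have [||//|e eP] := @fibre_independent p n.+1 s.
- exact: size_takel.
- by apply: take_uniq; apply: finmap.fset_uniq.
have {gP} /choice[C CP] : forall i, exists c : 'I_n -> R,
  e i = \sum_(j < n) f (c j) * (g j : A) by move=> i; apply: gP.
(* Row [i] of [C] holds coordinates of [e i] in the [n] generators; a dependence of the rows modulo
   [p] puts the same combination of the [e i] into every prime over [p]. *)
have [d [i pdi] dP] := prime_row_dependence p_prime C.
apply: pdi; apply: eP => Q /sp[Q_prime Qp].
under eq_bigr do rewrite CP mulr_sumr.
rewrite exchange_big; apply: prime_ideal_sum => // j /=.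
under eq_bigr do rewrite mulrA -rmorphM.
rewrite -mulr_suml -rmorph_sum; apply: prime_idealMr => //.
by have := dP j; rewrite -Qp.
Qed.

End Fibre.

(** * Associated primes of quotients of finitely generated modules *)

Section ColonPrimes.
Variables (R : comPzRingType) (M : lmodType R).
Implicit Types (N : set M) (x g : M).

Definition is_submodule N : Prop :=
  N 0 /\ forall (a : R) x y, N x -> N y -> N (a *: x + y).

Definition colon N x : set R := [set r | N (r *: x)].

(* [Ass (M / N)], stated without the quotient. *)
Definition colon_primes N : set (set R) :=
  [set p | prime_ideal p /\ exists x, p = colon N x].

Lemma Ass_quot_module (N : submodClosed M) :
  Ass (quot_module N) = colon_primes [set` N].
Proof.
have annE x : annihilator (quot_proj N x) = colon [set` N] x.
  apply/funext => r; apply/propext; rewrite /annihilator /colon /=.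
  have /= := quot_projP N (r *: x) 0.
  rewrite subr0 -quot_proj_scale => <-.
  suff -> : quot_proj N 0 = 0 by [].
  by rewrite -[X in quot_proj N X](scale0r 0) quot_proj_scale scale0r.
apply/seteqP; split=> p [p_prime [x px]]; split=> //; last first.
  by exists (quot_proj N x); rewrite annE.
by move: px; rewrite -[x]quot_proj_repr annE => ->; eexists.
Qed.

Lemma submodClosed_is_submodule (N : submodClosed M) : is_submodule [set` N].
Proof. by split=> [|a x y xN yN] /=; rewrite ?rpred0 // rpredD // rpredZ. Qed.

Lemma is_submodule_submodClosed N :
  is_submodule N -> exists N' : submodClosed M, [set` N'] = N.
Proof.
move=> [N0 Nlin].
pose S : {pred M} := [pred x | `[< N x >]].
have S_submod : submod_closed S.
  split=> [|a x y]; first exact/asboolP.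
  by move=> /asboolP Nx /asboolP Ny; apply/asboolP/Nlin.
pose N' : submodClosed M :=
  HB.pack S (GRing.isSubmodClosed.Build R M S S_submod).
by exists N'; apply/seteqP; split=> x /asboolP.
Qed.

Lemma weakly_LaskerianP :
  weakly_Laskerian M <->
  forall N, is_submodule N -> finite_set (colon_primes N).
Proof.
split=> [wL N /is_submodule_submodClosed[N' <-]|wL N].
  by rewrite -Ass_quot_module.
by rewrite Ass_quot_module; apply: wL; apply: submodClosed_is_submodule.
Qed.

Lemma is_submoduleZ N (a : R) x : is_submodule N -> N x -> N (a *: x).
Proof. by move=> [N0 Nlin] Nx; rewrite -[_ *: _]addr0; apply: Nlin. Qed.

Lemma is_submoduleDl N x y : is_submodule N -> N x -> N (x + y) = N y.
Proof.
move=> [_ Nlin] Nx; apply/propext; split=> [Nxy|Ny].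
  by rewrite -[y](addKr x) -scaleN1r; apply: Nlin.
by rewrite -[x]scale1r; apply: Nlin.
Qed.

(** For a submodule [N] this is [N + R g]. *)
Definition adjoin N g : set M := [set x | exists a : R, N (x - a *: g)].

Lemma adjoin_submodule N g : is_submodule N -> is_submodule (adjoin N g).
Proof.
move=> [N0 Nlin]; split=> [|r x y [a Nx] [b Ny]].
  by exists 0; rewrite scale0r subr0.
exists (r * a + b).
rewrite scalerDl -scalerA opprD addrACA -scalerBr; exact: Nlin.
Qed.

End ColonPrimes.

Lemma colon_submodule (R : comPzRingType) (M : lmodType R) (N : set M) g :
  is_submodule N -> is_submodule (colon N g : set (R^o : lmodType R)).
Proof.
move=> [N0 Nlin]; split=> [|r a b]; rewrite /colon /=; first by rewrite scale0r.
by move=> Na Nb; rewrite scalerDl -scalerA; apply: Nlin.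
Qed.

(* Relative form of [Ass M <= Ass M' `|` Ass (M / M')], with
   [M' = (N + R g) / N], which is isomorphic to [R / (N : g)]. *)
Lemma colon_primes_adjoin (R : comPzRingType) (M : lmodType R) (N : set M) g :
  is_submodule N ->
  colon_primes N `<=` colon_primes (adjoin N g) `|`
                      colon_primes (colon N g : set (R^o : lmodType R)).
Proof.
move=> Nsub p [p_prime [x px]].
have [N'p|/existsNP[r /not_implyP[[a Nra] pr]]] :=
    pselect (forall r, adjoin N g (r *: x) -> p r).
  left; split=> //; exists x; apply/seteqP; split=> // r.
  by rewrite px => Nrx; exists 0; rewrite scale0r subr0.
(* Since [r *: x] and [a *: g] agree modulo [N], the colon of [a] is that of [r *: x], which is
   still [p] because [r] is not in [p]. *)
right; split=> //; exists (a : R^o).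
apply/funext => t; rewrite /colon /=.
have -> : N ((t *: (a : R^o) : R^o) *: g) = N (t *: (r *: x)).
  rewrite -[r *: x](subrK (a *: g)) scalerDr is_submoduleDl //.
    by rewrite scalerA.
  exact: is_submoduleZ.
rewrite scalerA -[N _]/(colon N x (t * r)) -px; apply/propext.
by split=> [|/prime_idealM[]//]; apply: prime_idealMr.
Qed.

Lemma finitely_generated_weakly_Laskerian (R : comPzRingType) (M : lmodType R) :
  weakly_Laskerian_ring R -> finitely_generated M -> weakly_Laskerian M.
Proof.
move=> /weakly_LaskerianP R_wL [n [g gP]]; apply/weakly_LaskerianP => N Nsub.
(* Generation is weakened to generation modulo [N], so that the induction can absorb one generator
   at a time into [N]. *)
have {gP} : forall x, exists c : 'I_n -> R, N (x - \sum_(i < n) c i *: g i).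
  by move=> x; have [c ->] := gP x; exists c; rewrite subrr; case: Nsub.
elim: n g => [|n IH] g in N Nsub * => gP.
  (* Without generators [N] is all of [M], so every colon contains 1 and none is prime. *)
  apply: (sub_finite_set _ (finite_set0 _)) => p [p_prime [x px]].
  apply: (prime_ideal1 p_prime); rewrite px /colon /= scale1r.
  by have [c] := gP x; rewrite big_ord0 subr0.
apply: sub_finite_set (colon_primes_adjoin (g ord0) Nsub) _.
rewrite finite_setU; split; last exact/R_wL/colon_submodule.
apply: (IH (fun i => g (lift ord0 i))); first exact: adjoin_submodule.
move=> x; have [c Nx] := gP x; exists (fun i => c (lift ord0 i)), (c ord0).
by move: Nx; rewrite big_ord_recl opprD addrA addrAC.
Qed.

Theorem theorem5p2 (R A : comPzRingType) (f : {rmorphism R -> A})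
    (f_inj : injective f)
    (A_fg : finitely_generated (restrict_scalars f))
    (R_wL : weakly_Laskerian_ring R) :
  weakly_Laskerian_ring A.
Proof.
apply/weakly_LaskerianP => J [J0 Jlin].
have /weakly_LaskerianP/(_ (J : set (restrict_scalars f))) :=
  finitely_generated_weakly_Laskerian R_wL A_fg.
have Jsub : is_submodule (J : set (restrict_scalars f)).
  by split=> // a x y; apply: (Jlin (f a)).
move=> /(_ Jsub) finp.
apply: (sub_finite_set (B := \bigcup_(p in
  colon_primes (J : set (restrict_scalars f))) lies_over f p)); last first.
  by apply: bigcup_finite => // p [p_prime _]; apply: finite_fibre.
(* As [a *: x] unfolds to [f a * x], the preimage of the colon of [x] over [A] is its colon over
   [R]. *)
move=> Q [Q_prime [x Qx]]; exists (f @^-1` Q) => //.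
by split; [apply: prime_preimage | exists x; rewrite Qx].
Qed.
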